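(* Let $r\ge 1$ and $0\le s<r$ be integers. Let $b_1,\dots,b_r\in W$ and $b_1',\dots,b_r'\in W$ be two $r$-tuples, each of which satisfies the following condition (written for a tuple $(c_1,\dots,c_r)$): for every $1\le i\le r$ the element $c_i$ is conjugate under $W$ to $$\begin{cases}\sigma & \text{if } i=1 \text{ and } s>0,\\ (c_r,1)\,\sigma & \text{if } i=1 \text{ and } s=0,\\ (c_{i-1},1) & \text{if } 1<i\le r \text{ and } i\ne s+1,\\ (c_s,c_r) & \text{if } 1<i\le r \text{ and } i=s+1.\end{cases}$$ Then the closed subgroup of $W$ topologically generated by $b_1,\dots,b_r$ and the closed subgroup of $W$ topologically generated by $b_1',\dots,b_r'$ are conjugate in $W$.
   Context: $T$ is the infinite rooted binary tree whose vertices are the finite words over $\{0,1\}$, with root the empty word, each word $t$ being joined by an edge to $t0$ and $t1$. $W:=\operatorname{Aut}(T)$ is its automorphism group, a profinite group as the inverse limit of the finite groups $W_n=\operatorname{Aut}(T_n)$, where $T_n\subset T$ is the subtree of words of length $\le n$. For $u,v\in W$, $(u,v)\in W$ denotes the automorphism $0t\mapsto 0\,u(t)$, $1t\mapsto 1\,v(t)$ for all words $t$; $\sigma\in W$ is the automorphism of order $2$ with $0t\mapsto 1t$ and $1t\mapsto 0t$ for all words $t$. Thus $W=(W\times W)\rtimes\langle\sigma\rangle$. *)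

(* Defs.v *)
From HB Require Import structures.
From mathcomp Require Import all_boot.
From mathcomp Require Import all_classical topology.

Set Implicit Arguments.
Unset Strict Implicit.
Unset Printing Implicit Defensive.

Local Open Scope classical_set_scope.
Local Open Scope group_scope.

(* Letters 0 and 1 are [false] and [true]; the first letter of a word is the
   head of the list, so the children t0, t1 of t are obtained by [rcons]. *)
Definition word := seq bool.

Definition adjacent (x y : word) : bool :=
  [exists a : bool, (y == rcons x a) || (x == rcons y a)].

Definition is_tree_aut (f : word -> word) : Prop :=
  [/\ bijective f, f [::] = [::] & forall x y, adjacent (f x) (f y) = adjacent x y].

Record W := TreeAut { tree_fun :> word -> word; tree_funP : is_tree_aut tree_fun }.

Lemma W_ext (u v : W) : (forall t, u t = v t) -> u = v.
Proof.
case: u v => [f Pf] [g Pg] /= /funext fg; subst g.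
by congr TreeAut; apply: Prop_irrelevance.
Qed.

HB.instance Definition _ := gen_eqMixin W.
HB.instance Definition _ := gen_choiceMixin W.

Lemma id_tree_aut : is_tree_aut id.
Proof. by split=> //; exists id. Qed.

Lemma comp_tree_aut (u v : W) : is_tree_aut (u \o v).
Proof.
have [bf f0 fA] := tree_funP u; have [bg g0 gA] := tree_funP v; split=> /=.
- exact: bij_comp.
- by rewrite g0 f0.
- by move=> x y; rewrite fA gA.
Qed.

Lemma tree_inv_ex (u : W) : exists g, cancel u g /\ cancel g u.
Proof. by have [[g uK gK] _ _] := tree_funP u; exists g. Qed.

Definition tree_inv_fun (u : W) : word -> word := sval (cid (tree_inv_ex u)).

Lemma tree_invK (u : W) : cancel u (tree_inv_fun u) /\ cancel (tree_inv_fun u) u.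
Proof. exact: (svalP (cid (tree_inv_ex u))). Qed.

Lemma inv_tree_aut (u : W) : is_tree_aut (tree_inv_fun u).
Proof.
have [uK Ku] := tree_invK u; have [_ u0 uA] := tree_funP u; split.
- by exists u.
- by rewrite -[X in tree_inv_fun u X]u0 uK.
- by move=> x y; rewrite -uA !Ku.
Qed.

(* The product is composition of maps: (u * v)(t) = u(v(t)). *)
Definition W1 : W := TreeAut id_tree_aut.
Definition Wmul (u v : W) : W := TreeAut (comp_tree_aut u v).
Definition Winv (u : W) : W := TreeAut (inv_tree_aut u).

Lemma WmulA : associative Wmul.
Proof. by move=> u v w; apply: W_ext. Qed.

Lemma Wmul1g : left_id W1 Wmul.
Proof. by move=> u; apply: W_ext. Qed.

Lemma Wmulg1 : right_id W1 Wmul.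
Proof. by move=> u; apply: W_ext. Qed.

Lemma WmulVg : left_inverse W1 Winv Wmul.
Proof. by move=> u; apply: W_ext => t /=; have [uK _] := tree_invK u. Qed.

Lemma WmulgV : right_inverse W1 Winv Wmul.
Proof. by move=> u; apply: W_ext => t /=; have [_ Ku] := tree_invK u. Qed.

HB.instance Definition _ := isGroup.Build W WmulA Wmul1g Wmulg1 WmulVg WmulgV.

(* The fibre through w of the restriction map W -> W_n = Aut(T_n). *)
Definition fibre (n : nat) (w : W) : set W :=
  [set v : W | forall t : word, size t <= n -> v t = w t].

(* The inverse limit topology: the fibres of the maps W -> W_n, for all n,
   form a base. *)
Definition W_open (U : set W) : Prop :=
  forall w, U w -> exists n, fibre n w `<=` U.

Lemma W_openT : W_open setT.
Proof. by move=> w _; exists 0. Qed.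

Lemma W_openI : setI_closed W_open.
Proof.
move=> A B oA oB w [/oA[m mA] /oB[n nB]]; exists (maxn m n) => v vw; split.
- by apply: mA => t tm; apply: vw; rewrite leq_max tm.
- by apply: nB => t tn; apply: vw; rewrite leq_max tn orbT.
Qed.

Lemma W_open_bigU (I : Type) (f : I -> set W) :
  (forall i, W_open (f i)) -> W_open (\bigcup_i f i).
Proof.
move=> of_ w [i _ /of_[n nf]]; exists n => v /nf fv; by exists i.
Qed.

HB.instance Definition _ :=
  isOpenTopological.Build W W_openT W_openI W_open_bigU.

Definition pair_fun (u v : word -> word) (t : word) : word :=
  match t with
  | [::] => [::]
  | false :: t' => false :: u t'
  | true :: t' => true :: v t'
  end.

Definition sigma_fun (t : word) : word :=
  if t is a :: t' then ~~ a :: t' else [::].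

Lemma adjacent_sym x y : adjacent x y = adjacent y x.
Proof. by apply: eq_existsb => a; rewrite orbC. Qed.

Lemma adjacent_cons a b x y :
  adjacent (a :: x) (b :: y) = (a == b) && adjacent x y.
Proof.
apply/existsP/andP => [[c]|[/eqP-> /existsP[c h]]].
  by rewrite /= !eqseq_cons => /orP[]/andP[/eqP-> e]; rewrite eqxx; split=> //;
    apply/existsP; exists c; rewrite e ?orbT.
by exists c; rewrite /= !eqseq_cons eqxx.
Qed.

Lemma adjacent_nil b y : adjacent [::] (b :: y) = (y == [::]).
Proof.
apply/existsP/eqP => [[c]|->]; last by exists b; rewrite /= eqxx.
by rewrite /= eqseq_cons orbF => /andP[_ /eqP].
Qed.

Lemma tree_fun_eq0 (u : W) t : (u t == [::]) = (t == [::]).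
Proof.
by have [bu u0 _] := tree_funP u; rewrite -[in LHS]u0 (inj_eq (bij_inj bu)).
Qed.

Lemma pair_tree_aut (u v : W) : is_tree_aut (pair_fun u v).
Proof.
have [uK Ku] := tree_invK u; have [vK Kv] := tree_invK v; split=> //.
  exists (pair_fun (tree_inv_fun u) (tree_inv_fun v)) => -[|[] t] //=;
    by rewrite ?uK ?Ku ?vK ?Kv.
have [_ _ uA] := tree_funP u; have [_ _ vA] := tree_funP v.
move=> [|a x] [|b y] //.
- by case: b; rewrite /= !adjacent_nil tree_fun_eq0.
- by rewrite ![adjacent _ [::]]adjacent_sym;
    case: a; rewrite /= !adjacent_nil tree_fun_eq0.
- by case: a; case: b; rewrite /= !adjacent_cons //= ?uA ?vA.
Qed.

Lemma sigma_tree_aut : is_tree_aut sigma_fun.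
Proof.
have sK : cancel sigma_fun sigma_fun by case=> [|[] t].
split=> //; first by exists sigma_fun.
move=> [|a x] [|b y] //=; rewrite ?adjacent_cons ?adjacent_nil //.
- by rewrite ![adjacent _ [::]]adjacent_sym !adjacent_nil.
- by case: a; case: b.
Qed.

(* The automorphism (u, v). *)
Definition wpair (u v : W) : W := TreeAut (pair_tree_aut u v).

Definition sigma : W := TreeAut sigma_tree_aut.

Definition conjugate (x y : W) : Prop := exists w : W, x = y ^ w.

Definition conjugate_subgroups (G H : set W) : Prop :=
  exists w : W, G = [set h ^ w | h in H].

Definition closed_subgroup (H : set W) : Prop := closed H /\ group_closed (mem H).

Definition top_generated (S : set W) : set W := smallest closed_subgroup S.

(* 1-based entries: [entry c i] is c_i for 1 <= i <= r (the default value 1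
   is only reached outside this range). *)
Definition entry (r : nat) (c : r.-tuple W) (i : nat) : W := nth 1 c i.-1.

Definition recursion_rhs (r s : nat) (c : r.-tuple W) (i : nat) : W :=
  if i == 1%N then
    if 0 < s then sigma else wpair (entry c r) 1 * sigma
  else if i == s.+1 then wpair (entry c s) (entry c r)
  else wpair (entry c i.-1) 1.

Definition conj_recursive (r s : nat) (c : r.-tuple W) : Prop :=
  forall i : nat, 1 <= i <= r -> conjugate (entry c i) (recursion_rhs s c i).

(* Main.v *)
(* Pass to any finite level n. After conjugating in W, a solution b of the
   recursion takes the form b_1 = σ or (c_r, 1)σ, b_i = (c_(i-1), 1),
   b_(s+1) = (c_s, c_r), up to conjugating single entries by powers of b_1,
   where c is again a solution. By induction on n, any two solutions b and b'
   agree on level n up to conjugating each entry of b' inside the group it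
   generates and conjugating everything by some w in W. Indeed, when c_i is
   replaced by its conjugate under x_i w, the pairs (c_(i-1), 1) only need an
   element of the group generated by b' with first component x_(i-1), up to a
   common factor, and the projection onto the first component is surjective.
   Only (c_s, c_r) for s > 0 needs more. There all generators are involutions,
   and modulo the elements k with (1, k) in the group generated by b' the group
   generated by c is dihedral on c_s, c_r; the pairs (c_s, c_r) and (c_r, c_s)
   then absorb every relative conjugation.
   By compactness of W the element w can be chosen uniformly in n, which gives
   an inclusion of closed subgroups up to conjugation. By symmetry there is an
   inclusion in the other direction, and a closed subgroup mapped into itself by
   a conjugation is mapped onto itself, as elements of W have finite order on
   each level. *)

Require Import Defs.
From mathcomp Require Import all_boot.
From mathcomp Require Import all_classical topology.

Set Implicit Arguments.
Unset Strict Implicit.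
Unset Printing Implicit Defensive.

Local Open Scope classical_set_scope.
Local Open Scope group_scope.

(** * Sections of tree automorphisms *)

Lemma tree_inj (u : W) : injective u.
Proof. by have [/bij_inj] := tree_funP u. Qed.

Lemma tree_nil (u : W) : u [::] = [::].
Proof. by have [] := tree_funP u. Qed.

Lemma adjacentP x y :
  reflect (exists a, y = rcons x a \/ x = rcons y a) (adjacent x y).
Proof.
apply: (iffP existsP) => -[a h]; exists a.
  by case/orP: h => /eqP; [left | right].
by apply/orP; case: h => ->; [left | right].
Qed.

(** The image of a child is a neighbour of [u t]; by injectivity it is not the parent of [u t],
    which by induction is the image of the parent of [t]. *)
Lemma tree_rcons (u : W) t a : exists b, u (rcons t a) = rcons (u t) b.
Proof.
have [_ _ uA] := tree_funP u.
elim/last_ind: t a => [|t c IH] a; have := uA;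
  [move/(_ [::] [:: a])|move/(_ (rcons t c) (rcons (rcons t c) a))];
  rewrite -?cats1 ?cat0s.
  have -> : adjacent [::] [:: a] by apply/adjacentP; exists a; left.
  by move/adjacentP => [b []]; [exists b|rewrite tree_nil; case: (u _)].
rewrite !cats1; have -> : adjacent (rcons t c) (rcons (rcons t c) a).
  by apply/adjacentP; exists a; left.
move/adjacentP => [b []]; first by exists b.
have [c' ->] := IH c => /rcons_inj [/tree_inj tE _].
by have := congr1 size tE; rewrite !size_rcons => /eqP;
   rewrite -addn2 -{1}[size t]addn0 eqn_add2l.
Qed.

Lemma size_tree (u : W) t : size (u t) = size t.
Proof.
elim/last_ind: t => [|t a IH]; first by rewrite tree_nil.
by have [b ->] := tree_rcons u t a; rewrite !size_rcons IH.
Qed.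

Lemma tree_mulE (u v : W) t : (u * v) t = u (v t).
Proof. by []. Qed.

Lemma tree_VK (u : W) t : u^-1 (u t) = t.
Proof. by rewrite -tree_mulE mulVg. Qed.

Lemma tree_KV (u : W) t : u (u^-1 t) = t.
Proof. by rewrite -tree_mulE mulgV. Qed.

Lemma head_tree (u : W) a t : head a (u (a :: t)) = head a (u [:: a]).
Proof.
elim/last_ind: t => // t b IH; rewrite -rcons_cons.
have [c ->] := tree_rcons u (a :: t) b.
rewrite -IH headI; case E : (u (a :: t)) => //=.
by move: (size_tree u (a :: t)); rewrite E.
Qed.

Lemma wpairM u v u' v' : wpair u v * wpair u' v' = wpair (u * u') (v * v').
Proof. by apply: W_ext => -[|[] t]. Qed.

Lemma wpair11 : wpair 1 1 = 1.
Proof. by apply: W_ext => -[|[] t]. Qed.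

Lemma wpairV u v : (wpair u v)^-1 = wpair u^-1 v^-1.
Proof. by apply: mulg1_eq; rewrite wpairM !mulgV wpair11. Qed.

Lemma wpairJ u v u' v' : wpair u v ^ wpair u' v' = wpair (u ^ u') (v ^ v').
Proof. by rewrite !conjgE wpairV !wpairM. Qed.

Lemma sigma2 : sigma * sigma = 1.
Proof. by apply: W_ext => -[|[] t]. Qed.

Lemma sigmaV : sigma^-1 = sigma.
Proof. exact: mulg1_eq sigma2. Qed.

Lemma sigma_wpair u v : sigma * wpair u v = wpair v u * sigma.
Proof. by apply: W_ext => -[|[] t]. Qed.

Lemma wpairJsigma u v : wpair u v ^ sigma = wpair v u.
Proof. by rewrite conjgE sigmaV mulgA sigma_wpair -mulgA sigma2 mulg1. Qed.

Lemma sigmaJdiag u : sigma ^ wpair u u = sigma.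
Proof. by rewrite conjgE sigma_wpair wpairV mulgA wpairM !mulVg wpair11 mul1g. Qed.

Lemma section_tree_aut (w : W) a : w [:: a] = [:: a] ->
  is_tree_aut (fun t => behead (w (a :: t))).
Proof.
have sec (v : W) t : v [:: a] = [:: a] -> v (a :: t) = a :: behead (v (a :: t)).
  move=> va; have := head_tree v a t; have := size_tree v (a :: t).
  by case: (v (a :: t)) => //= b s _ ->; rewrite va.
move=> wa; have wVa : w^-1 [:: a] = [:: a] by rewrite -{1}wa tree_VK.
split=> [||x y].
- exists (fun t => behead (w^-1 (a :: t))) => t.
    by rewrite -(sec w) // tree_VK.
  by rewrite -(sec w^-1) // tree_KV.
- by rewrite wa.
- have [_ _ wA] := tree_funP w.
  by have := wA (a :: x) (a :: y); rewrite (sec w x wa) (sec w y wa) !adjacent_cons eqxx.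
Qed.

Lemma tree_fixed_pair (w : W) : w [:: false] = [:: false] ->
  exists u v, w = wpair u v.
Proof.
move=> w0; have w1 : w [:: true] = [:: true].
  have := size_tree w [:: true]; case E : (w [:: true]) => [|[] [|? ?]] // _.
  by have := tree_inj (etrans E (esym w0)).
exists (TreeAut (section_tree_aut w0)), (TreeAut (section_tree_aut w1)).
have := head_tree w; have := size_tree w => sw hw.
apply: W_ext => -[|a t] /=; first exact: tree_nil.
case: a; have := hw _ t; have := sw (_ :: t).
  by move/(_ true) => S /(_ true); rewrite w1; case: (w _) S => //= ? ? _ ->.
by move/(_ false) => S /(_ false); rewrite w0; case: (w _) S => //= ? ? _ ->.
Qed.

Lemma tree_decomp (w : W) : exists u v (e : bool), w = wpair u v * sigma ^+ e.
Proof.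
have := size_tree w [:: false]; case E : (w [:: false]) => [|a [|? ?]] // _.
case: a E => E; last first.
  by have [u [v ->]] := tree_fixed_pair E; exists u, v, false; rewrite mulg1.
have E' : (w * sigma) [:: false] = [:: false].
  rewrite tree_mulE /=; have := size_tree w [:: true].
  case F : (w [:: true]) => [|[] [|? ?]] // _.
  by have := tree_inj (etrans F (esym E)).
have [u [v wE]] := tree_fixed_pair E'; exists u, v, true.
by rewrite -wE -mulgA sigma2 mulg1.
Qed.

(** * Agreement on the first levels *)

Definition agree (n : nat) (u v : W) : Prop := fibre n v u.

Section Agree.
Variable n : nat.

Lemma agree_refl u : agree n u u. Proof. by []. Qed.

Lemma agree_sym u v : agree n u v -> agree n v u.
Proof. by move=> uv t /uv. Qed.

Lemma agree_trans v u w : agree n u v -> agree n v w -> agree n u w.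
Proof. by move=> uv vw t tn; rewrite uv // vw. Qed.

Lemma agreeM u v u' v' :
  agree n u v -> agree n u' v' -> agree n (u * u') (v * v').
Proof. by move=> uv uv' t tn; rewrite !tree_mulE uv' // uv // size_tree. Qed.

Lemma agreeV u v : agree n u v -> agree n u^-1 v^-1.
Proof.
move=> uv t tn; apply: (@tree_inj u).
by rewrite tree_KV uv ?size_tree // tree_KV.
Qed.

Lemma agreeJ u v u' v' :
  agree n u v -> agree n u' v' -> agree n (u ^ u') (v ^ v').
Proof. by move=> uv uv'; rewrite !conjgE; do !apply: agreeM => //; apply: agreeV. Qed.

Lemma agree_pair u v u' v' :
  agree n u u' -> agree n v v' -> agree n.+1 (wpair u v) (wpair u' v').
Proof. by move=> uu vv [|[] t] //= tn; rewrite ?uu ?vv. Qed.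

End Agree.

#[local] Hint Resolve agree_refl : core.

Lemma agree_le m n u v : (m <= n)%N -> agree n u v -> agree m u v.
Proof. by move=> mn uv t tm; apply: uv; apply: leq_trans mn. Qed.

Lemma agree0 u v : agree 0 u v.
Proof. by move=> [|? ?] // _; rewrite !tree_nil. Qed.

Lemma agree_eq u v : (forall n, agree n u v) -> u = v.
Proof. by move=> uv; apply: W_ext => t; apply: (uv (size t)). Qed.

(** A square never swaps the two halves of the tree, so it is a pair, and induction applies to both
    components. *)
Lemma agree_expg2 n (u : W) : agree n (u ^+ (2 ^ n)) 1.
Proof.
elim: n u => [|n IH] u; first exact: agree0.
have pairX x y k : wpair x y ^+ k = wpair (x ^+ k) (y ^+ k).
  by elim: k => [|k IHk]; rewrite ?wpair11 // !expgS IHk wpairM.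
rewrite expnS expgnA.
have [x [y [e ->]]] := tree_decomp u.
have [x' [y' ->]] : exists x' y', (wpair x y * sigma ^+ e) ^+ 2 = wpair x' y'.
  case: e; rewrite expg2 ?mulg1 ?wpairM; last by eexists; eexists.
  exists (x * y), (y * x).
  by rewrite mulgA -(mulgA (wpair x y)) sigma_wpair !mulgA wpairM -mulgA sigma2 mulg1.
by rewrite pairX -wpair11; apply: agree_pair; apply: IH.
Qed.

(** * Generated subgroups *)

Definition subgroup (H : set W) : Prop := group_closed (mem H).

Lemma subgroupP (H : set W) :
  subgroup H <-> H 1 /\ forall x y, H x -> H y -> H (x / y).
Proof.
split=> -[H1 HD]; split.
- by have := set_mem H1.
- by move=> x y Hx Hy; have := HD x y (mem_set Hx) (mem_set Hy) => /set_mem.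
- exact/mem_set.
- by move=> x y /set_mem Hx /set_mem Hy; apply/mem_set/HD.
Qed.

Definition generated (S : set W) : set W := smallest subgroup S.

Section Generated.
Variable S : set W.

Lemma generated1 : generated S 1.
Proof. by move=> M [/subgroupP[]]. Qed.

Lemma generatedF x y : generated S x -> generated S y -> generated S (x / y).
Proof.
move=> Sx Sy M [gM SM]; have [_ MD] := (subgroupP M).1 gM.
by apply: MD; [apply: Sx | apply: Sy].
Qed.

Lemma generatedV x : generated S x -> generated S x^-1.
Proof. by move=> Sx; rewrite -div1g; apply: generatedF => //; apply: generated1. Qed.

Lemma generatedM x y : generated S x -> generated S y -> generated S (x * y).
Proof. by move=> Sx /generatedV Sy; rewrite -[y]invgK; apply: generatedF. Qed.

Lemma generatedJ x y : generated S x -> generated S y -> generated S (x ^ y).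
Proof. by move=> Sx Sy; do !apply: generatedM => //; apply: generatedV. Qed.

Lemma generatedX x k : generated S x -> generated S (x ^+ k).
Proof.
move=> Sx; elim: k => [|k IH]; first exact: generated1.
by rewrite expgS; apply: generatedM.
Qed.

End Generated.

Lemma sub_generated S : S `<=` generated S.
Proof. exact: sub_gen_smallest. Qed.

Lemma generated_sub S H : subgroup H -> S `<=` H -> generated S `<=` H.
Proof. by move=> gH SH; apply: smallest_sub. Qed.

Lemma generated_ind (S : set W) (P : set W) :
  P 1 -> (forall x y, S y -> P x -> P (x * y)) ->
  (forall x y, S y -> P x -> P (x / y)) -> generated S `<=` P.
Proof.
move=> P1 PM PD x Sx; rewrite -[x]mul1g.
(* Stated as an equivalence, stability under right multiplication passes to inverses, so these [y]
   form a subgroup. *)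
suff H : generated S `<=` [set y | forall x, P x <-> P (x * y)].
  exact: (H x Sx 1).1.
apply: generated_sub => [|y Sy z]; last first.
  by split=> [Pz|Pzy]; [exact: PM | rewrite -(mulgK y z); exact: PD].
apply/subgroupP; split=> [z|y z Hy Hz t]; first by rewrite mulg1.
by rewrite Hy (Hz (t * (y / z))) mulgA mulgVK.
Qed.

(** * Uniqueness of the recursion on each level *)

Section Family.
Variable r : nat.

Definition gens (c : nat -> W) : set W := [set c i | i in [set i | 1 <= i <= r]%N].

Lemma mem_gens c i : (1 <= i <= r)%N -> generated (gens c) (c i).
Proof. by move=> ir; apply: sub_generated; exists i. Qed.

(** Only [w] is common to all entries, while [x] varies with [i]. This is weaker than simultaneous
    conjugacy, but on level [n] it still carries one generated group into a conjugate of the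
    other. *)
Definition similar_by (n : nat) (w : W) (b c : nat -> W) : Prop :=
  forall i, (1 <= i <= r)%N ->
    exists2 x, generated (gens c) x & agree n (b i) (c i ^ (x * w)).

Definition similar n b c : Prop := exists w, similar_by n w b c.

Lemma similar_by_generated n w b c g : similar_by n w b c ->
  generated (gens b) g -> exists2 h, generated (gens c) h & agree n g (h ^ w).
Proof.
move=> bc; set P := [set g | exists2 h, generated (gens c) h & agree n g (h ^ w)].
suff : generated (gens b) `<=` P by apply.
apply: generated_sub => [|_ [i ir <-]].
  apply/subgroupP; split=> [|x y [x' Gx xx'] [y' Gy yy']].
    by exists 1; [exact: generated1 | rewrite conj1g].
  exists (x' / y'); first by apply: generatedM => //; apply: generatedV.
  by rewrite conjMg conjVg; apply: agreeM => //; apply: agreeV.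
have [x Gx bE] := bc i ir; exists (c i ^ x); last by rewrite -conjgM.
by apply: generatedJ => //; apply: mem_gens.
Qed.

Lemma similar_trans n c b d : similar n b c -> similar n c d -> similar n b d.
Proof.
move=> [w bc] [w' cd]; exists (w' * w) => i ir.
have [x Gx bE] := bc i ir; have [y Gy cE] := cd i ir.
(* On level [n], [x] equals [z ^ w'], so it moves across [w'] into the group generated by [d]. *)
have [z Gz xE] := similar_by_generated cd Gx.
exists (y * z); first exact: generatedM.
apply: agree_trans bE _; rewrite (_ : y * z * _ = y * w' * (z ^ w' * w)).
  by rewrite [in X in agree _ _ X]conjgM; apply: agreeJ => //; apply: agreeM.
by rewrite conjgE !mulgA mulgK.
Qed.

Variable s : nat.
Hypothesis sr : (s < r)%N.

(** For [entry c] this is convertible to [recursion_rhs s c]. *)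
Definition lift_family (c : nat -> W) (i : nat) : W :=
  if i == 1%N then
    if (0 < s)%N then sigma else wpair (c r) 1 * sigma
  else if i == s.+1 then wpair (c s) (c r)
  else wpair (c i.-1) 1.

Let r_gt0 : (0 < r)%N. Proof. exact: leq_trans sr. Qed.

Lemma lift1 c : lift_family c 1 = wpair (if (0 < s)%N then 1 else c r) 1 * sigma.
Proof. by rewrite /lift_family eqxx; case: ifP => //; rewrite wpair11 mul1g. Qed.

Lemma liftSs c : (0 < s)%N -> lift_family c s.+1 = wpair (c s) (c r).
Proof. by move=> s0; rewrite /lift_family eqSS -leqn0 leqNgt s0 eqxx. Qed.

Lemma liftS c i : (0 < i)%N -> i != s -> lift_family c i.+1 = wpair (c i) 1.
Proof. by move=> i0 iNs; rewrite /lift_family !eqSS (negPf iNs) -leqn0 leqNgt i0. Qed.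

Variant index_spec i : Prop :=
| IndexR of i = r : index_spec i
| IndexS of (0 < s)%N & i = s : index_spec i
| IndexS' of (0 < i < r)%N & i != s : index_spec i.

Lemma index_cases i : (1 <= i <= r)%N -> index_spec i.
Proof.
case/andP=> i0; rewrite leq_eqVlt => /orP[/eqP|] ir; first exact: IndexR.
have [/eqP|iNs] := boolP (i == s); last by apply: IndexS'; rewrite ?i0.
by move=> is_; apply: IndexS; rewrite -?is_.
Qed.

Section Projection.
Variable c : nat -> W.
Let G := generated (gens c).
Let H := generated (gens (lift_family c)).

Lemma lift_swap x y : (0 < s)%N -> H (wpair x y) -> H (wpair y x).
Proof.
move=> s0 Hxy; rewrite -wpairJsigma; apply: generatedJ => //.
have -> : sigma = lift_family c 1 by rewrite lift1 s0 wpair11 mul1g.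
exact: mem_gens.
Qed.

Lemma lift_gen_s : (0 < s)%N -> H (wpair (c s) (c r)).
Proof. by move=> s0; rewrite -liftSs //; apply: mem_gens; rewrite ltnS. Qed.

Lemma lift_gen i : (0 < i < r)%N -> i != s -> H (wpair (c i) 1).
Proof. by case/andP => i0 ir iNs; rewrite -liftS //; apply: mem_gens. Qed.

(** It suffices to find each generator [c i] as a first component. *)
Lemma lift_proj1 x : G x -> exists y, H (wpair x y).
Proof.
have : G `<=` [set x | exists y, H (wpair x y)]; last by apply.
apply: generated_sub => [|_ [i ir <-]].
  apply/subgroupP; split=> [|y z [y' Hy] [z' Hz]].
    by exists 1; rewrite wpair11; apply: generated1.
  exists (y' / z'); rewrite -wpairM -wpairV.
  by apply: generatedM => //; apply: generatedV.
case: (index_cases ir) => [->|s0 ->|i0r iNs].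
- have [s0|s0] := posnP s; last first.
    by exists (c s); apply: lift_swap => //; apply: lift_gen_s.
  (* For [s = 0] the square of (c_r, 1)σ is (c_r, c_r). *)
  exists (c r); rewrite (_ : wpair _ _ = lift_family c 1 * lift_family c 1).
    by apply: generatedM => //; apply: mem_gens.
  rewrite lift1 s0 /= mulgA -(mulgA (wpair _ _)) sigma_wpair mulgA wpairM.
  by rewrite -mulgA sigma2 !mulg1 mul1g.
- by exists (c r); apply: lift_gen_s.
- by exists 1; apply: lift_gen.
Qed.

(** * The dihedral quotient for [s > 0] *)

Section Dihedral.
Hypothesis s_gt0 : (0 < s)%N.
Hypotheses (cs2 : c s * c s = 1) (cr2 : c r * c r = 1).
Let a := c s.
Let b := c r.
Let K : set W := [set k | H (wpair 1 k)].

Let Ga : G a. Proof. by apply: mem_gens; rewrite s_gt0 ltnW. Qed.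
Let Gb : G b. Proof. by apply: mem_gens; rewrite r_gt0 leqnn. Qed.

(** Projection followed by a swap shows that [x] is the second component of an element of [H];
    conjugate (1, k) by that element. *)
Let KJ k x : K k -> G x -> K (k ^ x).
Proof.
move=> Kk /lift_proj1[y /(lift_swap s_gt0) Hyx].
by rewrite /K /= -(conj1g y) -wpairJ; apply: generatedJ.
Qed.

Let K1 : K 1.
Proof. by rewrite /K /= wpair11; apply: generated1. Qed.

Let KM k l : K k -> K l -> K (k * l).
Proof. by move=> Kk Kl; rewrite /K /= -(mulg1 1) -wpairM; apply: generatedM. Qed.

Let Kgen i : (0 < i < r)%N -> i != s -> K (c i).
Proof. by move=> ir iNs; apply: lift_swap => //; apply: lift_gen. Qed.

Let KV k : K k -> K k^-1.
Proof. by move=> Kk; rewrite /K /= -invg1 -wpairV; apply: generatedV. Qed.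

(* Modulo the normal subgroup K, which contains the other generators, the group
   G is generated by the involutions a and b. *)
Lemma dihedral_normal_form x : G x ->
  exists (e f : bool) m, exists2 k, K k & x = b ^+ e * (a * b) ^+ m * a ^+ f * k.
Proof.
set P := [set x | exists (e f : bool) m,
  exists2 k, K k & x = b ^+ e * (a * b) ^+ m * a ^+ f * k].
have P1 : P 1.
  by exists false, false, 0, 1; rewrite ?mulg1.
have PK y k : K k -> P y -> P (y * k).
  move=> Kk [e [f [m [l Kl ->]]]]; exists e, f, m; exists (l * k); rewrite ?mulgA //.
  exact: KM.
have Pa y : P y -> P (y * a).
  move=> [e [f [m [k Kk ->]]]]; rewrite -mulgA (conjgC k) mulgA.
  apply: PK; first exact: KJ.
  exists e, (~~ f), m, 1; rewrite ?mulg1 //.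
  by case: f; rewrite /= ?mulg1 // -mulgA cs2 mulg1.
have Pb y : P y -> P (y * b).
  move=> [e [f [m [k Kk ->]]]]; rewrite -mulgA (conjgC k) mulgA.
  apply: PK; first exact: KJ.
  case: f.
    by exists e, false, m.+1, 1; rewrite ?mulg1 // [(a * b) ^+ m.+1]expgSr !mulgA.
  (* The new [b] flips [b ^+ e] if [m = 0]; otherwise it cancels the last letter of [(a * b) ^+ m]
     and leaves a trailing [a]. *)
  case: m => [|m].
    by exists (~~ e), false, 0, 1; rewrite ?mulg1 //; case: e; rewrite ?mul1g.
  exists e, true, m, 1; rewrite ?mulg1 // [(a * b) ^+ m.+1]expgSr !mulgA.
  by rewrite -(mulgA _ b b) cr2 mulg1.
have aV : a^-1 = a by apply: mulg1_eq.
have bV : b^-1 = b by apply: mulg1_eq.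
suff : G `<=` P by apply.
apply: generated_ind => // y _ [i ir <-]; case: (index_cases ir) => [->|_ ->|i0r iNs].
- exact: Pb.
- exact: Pa.
- by apply: PK => //; apply: Kgen.
- by rewrite -/b bV; apply: Pb.
- by rewrite -/a aV; apply: Pa.
- by apply: PK => //; apply: KV; apply: Kgen.
Qed.

(* The pair (g, h) is ((ab)^-j, (ab)^j) for m = 2j, times (b, a) on the right
   for m = 2j + 1. *)
Lemma dihedral_quotient m :
  exists g h, [/\ G g, H (wpair g h) & h / g = (a * b) ^+ m].
Proof.
have Hab : H (wpair a b) by apply: lift_gen_s.
have Hba : H (wpair b a) by apply: lift_swap.
have aV : a^-1 = a by apply: mulg1_eq.
have bV : b^-1 = b by apply: mulg1_eq.
elim/ltn_ind: m => -[|[|m]] IH.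
- by exists 1, 1; rewrite divg1 wpair11; split=> //; apply: generated1.
- by exists b, a; rewrite bV.
- have [g [h [Gg Hgh E]]] := IH m (leqnSn _).
  exists (b * a * g), (a * b * h); split.
  + by do !apply: generatedM.
  + by rewrite -!wpairM; do !apply: generatedM.
  + by rewrite expgS expgSr -E !invgM aV bV !mulgA.
Qed.

(* For x = b^e (ab)^m a^f k take h g^-1 = (ab)^m and q = g^-1 a^f, then correct
   h by a conjugate of k. *)
Lemma conj_pair_absorb x : G x ->
  exists g h q, [/\ H (wpair g h), G q, a ^ (g * q) = a & b ^ (h * q) = b ^ x].
Proof.
move=> /dihedral_normal_form[e [f [m [k Kk ->]]]].
have [g [h [Gg Hgh E]]] := dihedral_quotient m.
have powJ (y : W) (n : nat) : y ^ (y ^+ n) = y.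
  by rewrite conjgE; have := commuteX n (commute_refl y) => /= ->; rewrite mulKg.
have Gq : G (g^-1 * a ^+ f).
  by apply: generatedM => //; [apply: generatedV | apply: generatedX].
exists g, (h * k ^ (g^-1 * a ^+ f)^-1), (g^-1 * a ^+ f); split=> //.
- rewrite -[g]mulg1 -wpairM; apply: generatedM => //.
  by rewrite mulg1; apply: KJ => //; apply: generatedV.
- by rewrite mulVKg powJ.
(* The exponent on the left becomes [(a * b) ^+ m * a ^+ f * k]; the leading [b ^+ e] of [x]
   centralises [b]. *)
- rewrite -(mulgA h) -conjgCV !mulgA E -!mulgA.
  by rewrite [RHS]conjgM powJ.
Qed.

End Dihedral.
End Projection.

(** The common conjugator is taken diagonal, hence commutes with [sigma]. Its factor [q] is dictated
    by the first entry if [s = 0] and by (c_s, c_r) if [s > 0]; the entries (c_i, 1) adapt to any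
    [q]. *)
Lemma similar_lift n b c :
    ((0 < s)%N -> c s * c s = 1 /\ c r * c r = 1) ->
  similar n b c -> similar n.+1 (lift_family b) (lift_family c).
Proof.
move=> c2 [w bc]; set G := generated (gens c); set H := generated (gens (lift_family c)).
have [q Gq [q0 qs]] : exists2 q, G q &
    (s = 0 -> agree n (b r) (c r ^ (q * w))) /\
    ((0 < s)%N -> exists2 x, H x & agree n.+1 (lift_family b s.+1)
       (lift_family c s.+1 ^ (x * wpair (q * w) (q * w)))).
  have [y Gy brE] : exists2 x, G x & agree n (b r) (c r ^ (x * w)).
    by apply: bc; rewrite r_gt0 leqnn.
  have [->|s0] := posnP s; first by exists y.
  have [z Gz bsE] : exists2 x, G x & agree n (b s) (c s ^ (x * w)).
    by apply: bc; rewrite s0 ltnW.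
  have [cs2 cr2] := c2 s0.
  have Gyz : G (y / z) by apply: generatedM => //; apply: generatedV.
  have [g [h [q [Hgh Gq gE hE]]]] := conj_pair_absorb s0 cs2 cr2 Gyz.
  (* Then [c s] is conjugated by [g * q * z * w], which acts on it as [z * w], and [c r] by
     [h * q * z * w], which acts on it as [y * w]. *)
  exists (q * z); first exact: generatedM.
  split=> [s_0|_]; first by rewrite s_0 in s0.
  exists (wpair g h) => //; rewrite !liftSs // wpairM wpairJ; apply: agree_pair.
    by rewrite !mulgA -(mulgA _ z) conjgM gE.
  by rewrite !mulgA -(mulgA _ z) conjgM hE -conjgM mulgA mulgVK.
exists (wpair (q * w) (q * w)) => -[|[|i]] // ir.
  exists 1; first exact: generated1.
  rewrite mul1g !lift1; case: posnP => s0; last first.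
    by rewrite wpair11 mul1g sigmaJdiag.
  rewrite conjMg sigmaJdiag wpairJ conj1g; apply: agreeM => //.
  by apply: agree_pair => //; apply: q0.
have [is_|iNs] := eqVneq i.+1 s.
  by rewrite is_; apply: qs; rewrite -is_.
have [x Gx bE] : exists2 x, G x & agree n (b i.+1) (c i.+1 ^ (x * w)).
  by apply: bc; apply: ltnW.
(* The factor [x / q] turns the common [q * w] back into [x * w]; the uncontrolled [y] only
   conjugates 1. *)
have Gxq : G (x / q) by apply: generatedM => //; apply: generatedV.
have [y Hy] := lift_proj1 Gxq.
exists (wpair (x / q) y) => //; rewrite !liftS // wpairM wpairJ conj1g.
by apply: agree_pair; rewrite // mulgA mulgVK.
Qed.

(** * Solutions of the recursion and their normal form *)

Definition recursive (c : nat -> W) : Prop :=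
  forall i, (1 <= i <= r)%N -> conjugate (c i) (lift_family c i).

(** The first entry is conjugate to [sigma]; the others are conjugate to pairs, whose squares on
    level [n.+1] are governed by level [n]. *)
Lemma recursive_involution c i : recursive c -> (0 < s)%N ->
  (1 <= i <= r)%N -> c i * c i = 1.
Proof.
move=> rc s0 ir; apply: agree_eq => n.
elim: n i ir => [|n IH] i ir; first exact: agree0.
have [g ->] := rc i ir; rewrite -conjMg -(conj1g g); apply: agreeJ => //.
have [s1 r1] : (1 <= s <= r)%N /\ (1 <= r <= r)%N.
  by rewrite s0 ltnW // r_gt0 leqnn.
case: i ir => [|[|i]] // ir.
  by rewrite lift1 s0 wpair11 mul1g sigma2.
have [<-|iNs] := eqVneq s i.+1.
  by rewrite liftSs // wpairM -wpair11; apply: agree_pair; apply: IH.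
rewrite liftS 1?eq_sym // wpairM mulg1 -[X in agree _ _ X]wpair11.
by apply: agree_pair => //; apply: IH; apply: ltnW.
Qed.

Lemma conjugate_wpair u v u' v' :
  conjugate u u' -> conjugate v v' -> conjugate (wpair u v) (wpair u' v').
Proof. by move=> [x ->] [y ->]; exists (wpair x y); rewrite wpairJ. Qed.

Lemma conjugate_refl u : conjugate u u.
Proof. by exists 1; rewrite conjg1. Qed.

Lemma lift_conjugate b c : (forall i, conjugate (b i) (c i)) ->
  forall i, (1 <= i <= r)%N -> conjugate (lift_family b i) (lift_family c i).
Proof.
move=> bc [|[|i]] // ir.
  rewrite !lift1; case: ifP => _; first exact: conjugate_refl.
  have [x ->] := bc r; exists (wpair x x).
  by rewrite conjMg sigmaJdiag wpairJ conj1g.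
have [is_|iNs] := eqVneq i.+1 s.
  by rewrite is_ !liftSs -?is_ //; apply: conjugate_wpair.
by rewrite !liftS //; apply: conjugate_wpair => //; apply: conjugate_refl.
Qed.

Lemma conjugate_trans u v w : conjugate u v -> conjugate v w -> conjugate u w.
Proof. by move=> [x ->] [y ->]; exists (y * x); rewrite conjgM. Qed.

(** Like [sigma], the element (d, 1)σ represents the nontrivial coset of the pairs. *)
Lemma tree_decomp_lift1 d h : exists u v (e : bool),
  h = wpair u v * (wpair d 1 * sigma) ^+ e.
Proof.
have [u [v [[] ->]]] := tree_decomp h; last by exists u, v, false.
by exists (u / d), v, true; rewrite !expg1 mulgA wpairM mulgVK mulg1.
Qed.

Lemma recursive_normal_form b : recursive b ->
  exists c w (e : nat -> bool), recursive c /\ forall i, (1 <= i <= r)%N ->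
    b i = lift_family c i ^ (lift_family c 1 ^+ e i * w).
Proof.
move=> rb.
have rb' i : exists g : W, (1 <= i <= r)%N -> b i = lift_family b i ^ g.
  by have [/rb[g bE]|_] := boolP (1 <= i <= r)%N; [exists g | exists 1].
have [g gE] := choice rb'.
set d := if (0 < s)%N then 1 else b r.
have [u uE] := choice (fun i => tree_decomp_lift1 d (g i / g 1%N)).
have [v uvE] := choice uE.
have [e uveE] := choice uvE.
(* Entry [j < r] is the first component of entry [j.+1]. Entry [r] is the second component of entry
   [s.+1] if [s > 0]; if [s = 0] it sits in the first entry, which must stay unchanged. *)
pose k j := if j == r then if (0 < s)%N then v s.+1 else 1 else u j.+1.
pose c j := b j ^ k j.
have cb i : conjugate (c i) (b i) by exists (k i).
have bc i : conjugate (b i) (c i) by exists (k i)^-1; rewrite conjgK.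
have c1 : lift_family c 1 = lift_family b 1.
  by rewrite !lift1 /c /k eqxx; case: ifP => [|->] //; rewrite conjg1.
have b1 : lift_family b 1 = wpair d 1 * sigma by rewrite lift1.
(* With [g 1] as common conjugator, the first entry needs no power of the first lifted generator. *)
exists c, (g 1%N), (fun i => (i != 1%N) && e i); split=> [i ir|i ir].
  apply: conjugate_trans (cb i) _; apply: conjugate_trans (rb i ir) _.
  exact: lift_conjugate.
rewrite gE // c1; case: i ir => [|[|i]] // ir; first by rewrite c1 mul1g.
rewrite -[g i.+2](mulgVK (g 1%N)) uveE b1 -mulgA conjgM; congr (_ ^ _).
have kj : k i.+1 = u i.+2 by rewrite /k ltn_eqF.
have [is_|iNs] := eqVneq i.+1 s.
  rewrite is_ !liftSs -?is_ // wpairJ /c kj /k eqxx.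
  by rewrite -is_.
by rewrite !liftS // wpairJ conj1g /c kj.
Qed.

Lemma recursive_similar n b c : recursive b -> recursive c -> similar n b c.
Proof.
elim: n b c => [|n IH] b c rb rc.
  exists 1 => i _; exists 1; last exact: agree0.
  exact: generated1.
have r1 : (1 <= 1 <= r)%N by rewrite r_gt0.
have [b' [w [e [rb' bE]]]] := recursive_normal_form rb.
have [c' [w' [e' [rc' cE]]]] := recursive_normal_form rc.
apply: (@similar_trans _ (lift_family b')).
  exists w => i ir; exists (lift_family b' 1 ^+ e i); last by rewrite bE.
  by apply: generatedX; apply: mem_gens.
apply: (@similar_trans _ (lift_family c')).
  apply: similar_lift; last exact: IH.
  move=> s0; split; apply: recursive_involution => //; first by rewrite s0 ltnW.
  by rewrite r_gt0 leqnn.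
(* The last comparison runs backwards, so powers of the first lifted generator are rewritten as
   powers of [c 1]. *)
have c1 : c 1%N = lift_family c' 1 ^ w'.
  rewrite cE // conjgM; congr (_ ^ _); case: (e' 1%N); rewrite ?conjg1 //.
  by rewrite expg1 conjgE mulKg.
exists w'^-1 => i ir; exists (c 1%N ^- e' i).
  by apply: generatedV; apply: generatedX; apply: mem_gens.
rewrite cE // c1 -conjXg -conjgM [X in _ ^ X](_ : _ = 1) ?conjg1 //.
by rewrite -conjVg conjgE !mulgA mulgK mulgK mulgV.
Qed.

End Family.

(** * Compactness and closed subgroups *)

Lemma tree_aut_limit (f : word -> word) :
  (forall n, exists u : W, forall t, (size t <= n)%N -> f t = u t) ->
  is_tree_aut f.
Proof.
move=> fu.
have inj_f : injective f.
  move=> x y; have [u uE] := fu (maxn (size x) (size y)).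
  by rewrite !uE ?leq_maxl ?leq_maxr // => /tree_inj.
have surj_f y : exists x, f x = y.
  have [u uE] := fu (size y); exists (u^-1 y).
  by rewrite uE ?size_tree // tree_KV.
have [g gE] := choice surj_f.
split.
- by exists g => // x; apply: inj_f; rewrite gE.
- by have [u uE] := fu 0; rewrite uE // tree_nil.
- move=> x y; have [u uE] := fu (maxn (size x) (size y)).
  have [_ _ uA] := tree_funP u.
  by rewrite !uE ?leq_maxl ?leq_maxr // uA.
Qed.

Lemma openWE (U : set W) : open U = W_open U.
Proof. by []. Qed.

Lemma fibre_nbhs n (w : W) : nbhs w (fibre n w).
Proof.
apply: open_nbhs_nbhs; split; last exact: agree_refl.
by move=> v vw; exists n => u uv; apply: agree_trans uv vw.
Qed.

Lemma nbhs_fibre (w : W) A : nbhs w A -> exists n, fibre n w `<=` A.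
Proof.
rewrite nbhsE => -[B [oB Bw] BA].
by have [n nB] := oB w Bw; exists n => v /nB /BA.
Qed.

(** An ultrafilter decides the image of each word letter by letter, and these limit values form an
    automorphism. *)
Lemma W_compact : compact [set: W].
Proof.
rewrite compact_ultra => F UF _.
have ex_value t : exists y, F [set u : W | u t = y].
  elim/last_ind: t => [|t a [y Fy]].
    by exists [::]; apply: filterS filterT => u _; apply: tree_nil.
  have [Fa|Fa] := in_ultra_setVsetC [set u : W | u (rcons t a) = rcons y true] UF.
    by exists (rcons y true).
  exists (rcons y false); apply: filterS (filterI Fy Fa) => u [/= uy].
  by have [[] ->] := tree_rcons u t a; rewrite uy.
have [f Ff] := choice ex_value.
have Fn n : F [set u : W | forall t, (size t <= n)%N -> u t = f t].
  (* Words of length at most [n] are indexed by finite types, so finite intersections suffice. *)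
  have Fall : F [set u : W | forall (k : 'I_n.+1) (t : k.-tuple bool), u t = f t].
    by do 2!apply: filter_forall => ?; apply: Ff.
  apply: filterS Fall => u uf t tn.
  exact: (uf (Ordinal (tn : (size t < n.+1)%N)) (in_tuple t)).
have aut_f : is_tree_aut f.
  apply: tree_aut_limit => n; have [u uf] := filter_ex (Fn n).
  by exists u => t /uf.
exists (TreeAut aut_f); split=> // A /nbhs_fibre[n nA].
by apply: filterS (Fn n) => u uf; apply: nA.
Qed.

Lemma agree_cluster (w : nat -> W) :
  exists p, forall n, exists2 m, (n <= m)%N & agree n (w m) p.
Proof.
have [p [_ pw]] := W_compact (F := w @ \oo) _ filterT.
exists p => n.
have wn : (w @ \oo) [set w m | m in [set m | (n <= m)%N]].
  by exists n => // m nm; exists m.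
by have [_ [[m nm <-] wp]] := pw _ _ wn (fibre_nbhs n p); exists m.
Qed.

(** The topological closure of the abstract group generated by [S], described level by level. *)
Definition agree_closure (S : set W) : set W :=
  [set v | forall n, exists2 g, generated S g & agree n v g].

Lemma top_generatedE S : top_generated S = agree_closure S.
Proof.
apply/seteqP; split.
  apply: smallest_sub => [|x Sx n]; last by exists x => //; apply: sub_generated.
  split.
    rewrite -openC openWE => w /= /existsNP[n wn]; exists n => v vw vS; apply: wn.
    by have [g Sg vg] := vS n; exists g => //; apply: agree_trans vg; apply: agree_sym.
  apply/subgroupP; split=> [|x y Sx Sy] n; first by exists 1 => //; apply: generated1.
  have [x' Sx' xx'] := Sx n; have [y' Sy' yy'] := Sy n.
  by exists (x' / y'); [exact: generatedF | apply: agreeM => //; apply: agreeV].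
move=> v Sv M [[cM gM] SM]; apply: contrapT => nMv.
have := closed_openC cM; rewrite openWE => /(_ v nMv)[n nM].
have [g Sg vg] := Sv n; apply: (nM g); first exact: agree_sym.
exact: generated_sub gM SM _ Sg.
Qed.

Lemma agree_closure_idem S v :
  (forall n, exists2 g, agree_closure S g & agree n v g) -> agree_closure S v.
Proof.
move=> vS n; have [g /(_ n)[h Sh gh] vg] := vS n.
by exists h => //; apply: agree_trans vg gh.
Qed.

Lemma agree_closureJ r b c : (forall n, similar r n b c) ->
  exists w, forall g, agree_closure (gens r b) g ->
    agree_closure (gens r c) (g ^ w^-1).
Proof.
move=> /choice[w bc]; have [p pw] := agree_cluster w; exists p => g gb n.
have [m nm wp] := pw n; have [g' Gg gg'] := gb n.
have [h Gh g'h] := similar_by_generated (bc m) Gg; exists h => //.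
(* Since [n <= m], the similarity on level [m] restricts to level [n], where [w m] agrees with the
   limit [p]. *)
rewrite -[h](conjgK p); apply: agreeJ => //.
apply: agree_trans gg' (agree_trans (agree_le nm g'h) _).
exact: agreeJ.
Qed.

(* [w] has finite order on each level, so there [w^-1] acts as a power of [w]. *)
Lemma agree_closureJV S w :
  (forall g, agree_closure S g -> agree_closure S (g ^ w)) ->
  forall g, agree_closure S g -> agree_closure S (g ^ w^-1).
Proof.
move=> Sw g Sg; have SX k : agree_closure S (g ^ (w ^+ k)).
  elim: k => [|k IH]; first by rewrite conjg1.
  by rewrite expgSr conjgM; apply: Sw.
apply: agree_closure_idem => n; exists (g ^ (w ^+ (2 ^ n).-1)) => //.
apply: agreeJ => //; apply: agree_sym.
rewrite -[X in agree _ X _](mulgK w) -expgSr prednK ?expn_gt0 //.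
rewrite -[X in agree _ _ X]mul1g.
by apply: agreeM => //; apply: agree_expg2.
Qed.

Lemma gens_entry r (b : r.-tuple W) : gens r (entry b) = [set` b].
Proof.
apply/seteqP; split=> [_ [i /andP[i0 ir] <-]|x /= /(nthP 1)[i ir <-]].
  by apply: mem_nth; rewrite size_tuple prednK.
by exists i.+1 => //=; rewrite -(size_tuple b).
Qed.

Theorem theorem0p3 (r s : nat) (hr : (1 <= r)%N) (hs : (s < r)%N)
    (b b' : r.-tuple W)
    (hb : conj_recursive s b) (hb' : conj_recursive s b') :
  conjugate_subgroups (top_generated [set` b]) (top_generated [set` b']).
Proof.
rewrite !top_generatedE -!gens_entry.
have [w bw] := agree_closureJ (fun n => recursive_similar hs n hb hb').
have [w' bw'] := agree_closureJ (fun n => recursive_similar hs n hb' hb).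
exists w; apply/seteqP; split=> [g /bw Gg|_ [h Gh <-]].
  by exists (g ^ w^-1); rewrite ?conjgKV.
(* The two inclusions compose to a conjugation of the first group into itself. It is onto, so
   undoing it on [h ^ w'^-1] puts [h ^ w] in the first group. *)
have stable g : agree_closure (gens r (entry b)) g ->
    agree_closure (gens r (entry b)) (g ^ (w^-1 / w')).
  by move=> /bw /bw'; rewrite -conjgM.
have := agree_closureJV stable (bw' _ Gh).
by rewrite -conjgM invgF invgK mulKg.
Qed.
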